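(* Let $n\ge 4$ be an integer with $n\equiv 2,6,10,14,18,26,30,34,38,42,46$ or $54 \pmod{56}$. Then there exists a configuration $(2,4)$ $GDD\left(n,2,6;\frac{7n}{2},4(n-1)\right)$.
   Context: A $GDD(n,2,6;\lambda_1,\lambda_2)$ is a finite collection (repetitions allowed) of $6$-element subsets, called blocks, of a $2n$-element set $X$ partitioned into two groups of size $n$, such that every point lies in the same number $r$ of blocks, any two distinct points of the same group lie together in exactly $\lambda_1$ blocks, and any two points from different groups lie together in exactly $\lambda_2$ blocks. It has configuration $(2,4)$ if every block has exactly $2$ points in one of the two groups and $4$ points in the other (which group contains the $2$ points may depend on the block). *)

(* Defs.v *)
From mathcomp Require Import all_boot.
Set Implicit Arguments.
Unset Strict Implicit.
Unset Printing Implicit Defensive.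

(* The groups of the design are the members of P.  Blocks form a list because
   repeated blocks are allowed; [count] counts them with multiplicity. *)
Definition is_GDD (n m k lambda1 lambda2 : nat) (X : finType)
    (P : {set {set X}}) (B : seq {set X}) : Prop :=
  [/\ [/\ partition P [set: X], #|P| = m & forall G, G \in P -> #|G| = n],
      (forall b, b \in B -> #|b| = k),
      (exists r : nat, forall x : X, count (fun b : {set X} => x \in b) B = r),
      (forall (G : {set X}) (x y : X),
         G \in P -> x \in G -> y \in G -> x != y ->
         count (fun b : {set X} => (x \in b) && (y \in b)) B = lambda1)
    & (forall (G H : {set X}) (x y : X),
         G \in P -> H \in P -> G != H -> x \in G -> y \in H ->
         count (fun b : {set X} => (x \in b) && (y \in b)) B = lambda2)].

(* Intended for designs with two groups: G and H below are then the two groups,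
   in an order that may vary with the block. *)
Definition has_configuration (s t : nat) (X : finType)
    (P : {set {set X}}) (B : seq {set X}) : Prop :=
  forall b, b \in B ->
    exists G H : {set X},
      [/\ G \in P, H \in P, G != H, #|b :&: G| = s & #|b :&: H| = t].

(* Main.v *)
Require Import Defs.
From HB Require Import structures.
From mathcomp Require Import all_boot all_algebra fingroup cyclic finfield zify ring.
Set Implicit Arguments.
Unset Strict Implicit.
Unset Printing Implicit Defensive.
Import GRing.Theory.

(* All the n in question are even.  Let D be a BIBD(n, 4, 6), of size
   (n/2)(n-1), and F_1, ..., F_{n-1} a one-factorization of K_n.  Match the members of D with
   the F_j so that each F_j is used n/2 times; a member Q matched with F_j gives
   the n/2 blocks consisting of Q in one group and an edge of F_j in the other,
   for both choices of the group of Q.  A pair inside a group is then covered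
   6(n/2) + n/2 times, and a pair across the groups r + r = 4(n-1) times, where
   r = 2(n-1) is the replication number of D.

   Write v = n - 1, which is odd, and take an abelian group V of order v.  If V
   has an odd map f such that f, f + 1 and f - 1 are bijective, the
   parallelograms t + {0, x, f x, x + f x}, with x up to sign, form a
   BIBD(v, 4, 6), and replacing one base block by two triangles through a new
   point oo gives a BIBD(v + 1, 4, 6).  Doubling is such a map when v is prime
   to 6, and so is multiplication by a notin {0, 1, -1} in a finite field of
   more than 3 elements; products then cover every odd v except those exactly
   divisible by 3.  In that last case v = 3u with u prime to 6, and a
   BIBD(u, 4, 6) is tripled with the orthogonal array OA(9, 4, 3), the fibers
   of size 3 being completed by oo. *)

(** * Double counting in block designs *)

Section Counting.
Variable T : finType.
Implicit Types (D : seq {set T}) (b : {set T}) (x y : T).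

Definition is_BIBD (k lambda : nat) D : Prop :=
  (forall b, b \in D -> #|b| = k) /\
  (forall x y, x != y -> count (fun b => (x \in b) && (y \in b)) D = lambda).

Lemma count_sum (A : Type) (p : pred A) s : count p s = \sum_(a <- s) p a.
Proof. by elim: s => [|a s IHs]; rewrite ?big_nil // big_cons /= IHs. Qed.

Lemma sum_mem b : \sum_x (x \in b) = #|b|.
Proof. by rewrite -sum1_card [RHS]big_mkcond; apply: eq_bigr => x _; case: ifP. Qed.

Lemma sum_eq_op (A : finType) (a : A) : \sum_(c : A) (a == c) = 1.
Proof.
by rewrite (bigD1 a) //= eqxx big1 ?addn0 // => c; rewrite eq_sym => /negPf->.
Qed.

Lemma sum_bool c (F : bool -> nat) : \sum_d F d = F c + F (~~ c).
Proof. by rewrite big_bool; case: c; rewrite ?(addnC (F false)). Qed.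

Lemma eq_negb c : (c == ~~ c) = false.
Proof. by case: c. Qed.

Lemma negb_eq c : (~~ c == c) = false.
Proof. by case: c. Qed.

Lemma size_BIBD_replication D k r :
  (forall b, b \in D -> #|b| = k) ->
  (forall x, count (fun b => x \in b) D = r) -> size D * k = #|T| * r.
Proof.
move=> card_b count_x.
have <- : \sum_x count (fun b => x \in b) D = #|T| * r.
  by rewrite (eq_bigr (fun=> r)) ?sum_nat_const.
under eq_bigr do rewrite count_sum.
rewrite exchange_big /= big_seq (eq_bigr (fun=> k)); last first.
  by move=> b bD; rewrite sum_mem card_b.
by rewrite -big_seq big_const_seq count_predT iter_addn_0 mulnC.
Qed.

(** Double counting of the pairs of a point y other than x and a block containing both x and y. *)
Lemma BIBD_replication D k lambda x : is_BIBD k lambda D ->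
  count (fun b => x \in b) D * k.-1 = #|T|.-1 * lambda.
Proof.
move=> [card_b count_xy].
have <- : \sum_(y | y != x) count (fun b => (x \in b) && (y \in b)) D
          = #|T|.-1 * lambda.
  rewrite (eq_bigr (fun=> lambda)); last by move=> y; rewrite eq_sym => /count_xy.
  by rewrite sum_nat_const cardC1.
under eq_bigr do rewrite count_sum.
rewrite exchange_big /= count_sum big_distrl /= big_seq [RHS]big_seq.
apply: eq_bigr => b bD; case xb: (x \in b) => /=; last by rewrite big1.
by rewrite mul1n -(card_b b bD) -sum_mem (bigD1 x) //= xb.
Qed.

End Counting.

(** * The group divisible design from a BIBD and a one-factorization *)

Section GroupDivisible.
Variables (T I : finType) (D : seq {set T}) (E : I -> seq {set T}).
Variables (h : nat).
Hypothesis cardT : #|T| = h.*2.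
Hypothesis h_gt0 : 0 < h.
Hypothesis cardI : #|I| = h.*2.-1.
Hypothesis D_BIBD : is_BIBD 4 6 D.
Hypothesis E_card : forall i e, e \in E i -> #|e| = 2.
Hypothesis E_cover : forall i x, count (fun e : {set T} => x \in e) (E i) = 1.
Hypothesis E_pair : forall x y, x != y ->
  \sum_i count (fun e : {set T} => (x \in e) && (y \in e)) (E i) = 1.

Definition group c : {set bool * T} := [set p | p.1 == c].
Definition mixed_block c (Q e : {set T}) : {set bool * T} :=
  [set p | if p.1 == c then p.2 \in Q else p.2 \in e].
(** Every index of [I] occurs h times. Both lists have length h(2h - 1), so [zip] drops nothing. *)
Definition schedule : seq ({set T} * I) := zip D (flatten (nseq h (enum I))).
Definition blocks : seq {set bool * T} :=
  flatten [seq [seq mixed_block c q.1 e | e <- E q.2]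
             | c <- [:: true; false], q <- schedule].

Lemma size_factor i : size (E i) = h.
Proof.
have := size_BIBD_replication (E_card (i := i)) (E_cover i).
by rewrite cardT muln1 muln2 => /double_inj.
Qed.

Lemma count_D x : count (fun b : {set T} => x \in b) D = 2 * h.*2.-1.
Proof. have := BIBD_replication x D_BIBD; rewrite cardT; lia. Qed.

Lemma size_D : size D = h * h.*2.-1.
Proof.
have := size_BIBD_replication D_BIBD.1 count_D; rewrite cardT; nia.
Qed.

Lemma size_schedule_snd : size (flatten (nseq h (enum I))) = size D.
Proof.
by rewrite size_flatten /shape map_nseq sumn_nseq -cardE cardI size_D mulnC.
Qed.

Lemma sum_schedule_fst (F : {set T} -> nat) :
  \sum_(q <- schedule) F q.1 = \sum_(b <- D) F b.
Proof.
rewrite -[X in _ = \sum_(b <- X) _](@unzip1_zip _ _ D (flatten (nseq h (enum I)))).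
  by rewrite big_map.
by rewrite size_schedule_snd.
Qed.

Lemma sum_schedule_snd (F : I -> nat) :
  \sum_(q <- schedule) F q.2 = h * \sum_i F i.
Proof.
transitivity (\sum_(i <- flatten (nseq h (enum I))) F i).
  rewrite -[X in _ = \sum_(b <- X) _](@unzip2_zip _ _ D) ?big_map //.
  by rewrite size_schedule_snd.
elim: h => [|k IHk] /=; first by rewrite big_nil.
by rewrite big_cat IHk mulSn big_enum.
Qed.

Lemma sum_blocks (F : {set bool * T} -> nat) :
  \sum_(b <- blocks) F b =
  \sum_c \sum_(q <- schedule) \sum_(e <- E q.2) F (mixed_block c q.1 e).
Proof.
rewrite big_flatten /= !big_cat !big_map big_nil /= addn0 big_bool.
by congr (_ + _); apply: eq_bigr => q _; rewrite big_map.
Qed.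

Lemma blocksP b : b \in blocks -> exists c Q e i,
  [/\ b = mixed_block c Q e, Q \in D & e \in E i].
Proof.
case/flattenP => s /allpairsP [[c q] /= [_ qS ->]] /mapP [e eE ->].
exists c, q.1, e, q.2; split => //.
rewrite -[D](@unzip1_zip _ _ _ (flatten (nseq h (enum I)))) ?size_schedule_snd //.
exact: map_f.
Qed.

Lemma card_mixed_block_group c d Q e :
  #|mixed_block c Q e :&: group d| = if d == c then #|Q| else #|e|.
Proof.
have -> : mixed_block c Q e :&: group d =
          (fun x => (d, x)) @: (if d == c then Q else e).
  apply/setP => -[a x]; rewrite !inE /=; apply/andP/imsetP => [[xb /eqP ad]|].
    by exists x; rewrite -ad //; move: xb; case: ifP.
  by case=> y yb [-> ->]; rewrite eqxx; case: ifP yb.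
by rewrite card_imset; [case: ifP | move=> x y []].
Qed.

Lemma card_mixed_block c Q e : #|mixed_block c Q e| = #|Q| + #|e|.
Proof.
rewrite -(cardsID (group c)) card_mixed_block_group eqxx; congr (_ + _).
have -> : mixed_block c Q e :\: group c = mixed_block c Q e :&: group (~~ c).
  by apply/setP => -[a x]; rewrite !inE /= andbC; case: a; case: c.
by rewrite card_mixed_block_group; case: c.
Qed.

Lemma sum_factor_const i (n : nat) : \sum_(e <- E i) n = h * n.
Proof. by rewrite big_const_seq count_predT size_factor iter_addn_0 mulnC. Qed.

(** If the member of [D] lies in group c, each of the 6 members through x and y occurs with h edges.
    Otherwise {x, y} must be the edge: it lies in one factor, which is used h times. Hence 6h +
    h. *)
Lemma count_blocks_group c x y : x != y ->
  count (fun b : {set bool * T} => ((c, x) \in b) && ((c, y) \in b)) blocks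
  = 7 * h.
Proof.
move=> xy; rewrite count_sum sum_blocks (sum_bool c).
under eq_bigr => q _.
  under eq_bigr => e _ do rewrite !inE /= eqxx.
  rewrite sum_factor_const; over.
rewrite -big_distrr /= (sum_schedule_fst (fun b => (x \in b) && (y \in b))).
rewrite -count_sum D_BIBD.2 //.
under eq_bigr => q _.
  under eq_bigr => e _ do rewrite !inE /= eq_negb.
  rewrite -count_sum; over.
rewrite (sum_schedule_snd (fun i => count (fun e : {set T} => (x \in e) && (y \in e)) (E i))).
by rewrite E_pair //; lia.
Qed.

(** Each factor has exactly one edge through y, so only the replication number of [D] at x remains,
    whatever the matching. *)
Lemma sum_blocks_cross c x y :
  \sum_(q <- schedule) \sum_(e <- E q.2)
    ((((c, x) \in mixed_block c q.1 e) && ((~~ c, y) \in mixed_block c q.1 e)) : nat)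
  = 2 * h.*2.-1.
Proof.
under eq_bigr => q _.
  under eq_bigr => e _.
    rewrite !inE /= eqxx negb_eq.
    rewrite -mulnb; over.
  rewrite -big_distrr /= -count_sum E_cover muln1; over.
by rewrite (sum_schedule_fst (fun b => x \in b)) -count_sum count_D.
Qed.

Lemma count_blocks_cross c x y :
  count (fun b : {set bool * T} => ((c, x) \in b) && ((~~ c, y) \in b)) blocks
  = 4 * h.*2.-1.
Proof.
rewrite count_sum sum_blocks (sum_bool c).
rewrite sum_blocks_cross.
(* The blocks with their four points in the other group: the same count with the roles of the two
   points exchanged. *)
have := sum_blocks_cross (~~ c) y x; rewrite negbK.
under eq_bigr do under eq_bigr do rewrite andbC.
by move=> ->; lia.
Qed.

Lemma count_blocks_point p :
  count (fun b : {set bool * T} => p \in b) blocks = 3 * h * h.*2.-1.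
Proof.
case: p => c x.
rewrite count_sum sum_blocks (sum_bool c).
under eq_bigr => q _.
  under eq_bigr => e _ do rewrite !inE /= eqxx.
  rewrite sum_factor_const; over.
rewrite -big_distrr /= (sum_schedule_fst (fun b => x \in b)).
rewrite -count_sum count_D.
under eq_bigr => q _.
  under eq_bigr => e _ do rewrite !inE /= eq_negb.
  rewrite -count_sum; over.
rewrite (sum_schedule_snd (fun i => count (fun e : {set T} => x \in e) (E i))).
under eq_bigr do rewrite E_cover.
by rewrite sum_nat_const cardI; lia.
Qed.

Lemma GDD_blocks :
  let P := [set group true; group false] in
  is_GDD h.*2 2 6 (7 * h) (4 * h.*2.-1) P blocks /\ has_configuration 2 4 P blocks.
Proof.
have T0 : 0 < #|T| by rewrite cardT double_gt0.
have [x0 _] := card_gt0P T0.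
have neqG : group true != group false.
  by apply/eqP => /setP /(_ (true, x0)); rewrite !inE.
move=> P; have inP G : G \in P -> exists c, G = group c.
  by rewrite !inE => /orP [] /eqP ->; [exists true|exists false].
have groupP c : group c \in P by case: c; rewrite !inE eqxx ?orbT.
split; [split|].
- split.
  + apply/and3P; split.
    * rewrite eqEsubset subsetT; apply/subsetP => -[c x] _.
      by apply/bigcupP; exists (group c); rewrite ?groupP // inE.
    * apply/trivIsetP => _ _ /inP [c ->] /inP [d ->] ncd.
      rewrite -setI_eq0; apply/eqP/setP => -[a x]; rewrite !inE /=.
      by apply/andP => -[/eqP ac /eqP ad]; rewrite -ac -ad eqxx in ncd.
    * by apply/negP => /inP [c] /setP /(_ (c, x0)); rewrite !inE eqxx.
  + by rewrite cards2 neqG.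
  + move=> _ /inP [c ->].
    (* Writing the group as the trace of a mixed block makes its size a case of
       [card_mixed_block_group]. *)
    have -> : group c = mixed_block c setT set0 :&: group c.
      by apply/setP => p; rewrite !inE; case: eqP.
    by rewrite card_mixed_block_group eqxx cardsT.
- move=> _ /blocksP [c [Q [e [i [-> QD eE]]]]].
  by rewrite card_mixed_block (D_BIBD.1 _ QD) (E_card eE).
- by exists (3 * h * h.*2.-1); apply: count_blocks_point.
- move=> _ [a x] [b y] /inP [c ->]; rewrite !inE /= => /eqP -> /eqP -> xy.
  by apply: count_blocks_group; apply: contraNneq xy => ->.
- move=> _ _ [a x] [b y] /inP [c ->] /inP [d ->] ncd.
  rewrite !inE /= => /eqP -> /eqP ->.
  have -> : d = ~~ c by move: ncd; case: c; case: d; rewrite ?eqxx.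
  exact: count_blocks_cross.
- move=> _ /blocksP [c [Q [e [i [-> QD eE]]]]].
  exists (group (~~ c)), (group c); split => //.
  + by case: c => //=; rewrite eq_sym.
  + by rewrite card_mixed_block_group (E_card eE); case: c.
  + by rewrite card_mixed_block_group eqxx (D_BIBD.1 _ QD).
Qed.

End GroupDivisible.

(** * Multiples in finite abelian groups *)

(** Both k and the group order annihilate x, hence so does their gcd 1, by a Bezout relation. *)
Lemma mulrn_eq0_coprime (V : finZmodType) k (x : V) :
  0 < k -> coprime #|V| k -> (x *+ k = 0 -> x = 0)%R.
Proof.
move=> k0; rewrite coprime_sym => co xk0.
have xV : (x *+ #|V| = 0)%R.
  by rewrite -FinRing.zmodXgE -cardsT; apply: (expg_cardG (in_setT x)).
case: (egcdnP #|V| k0) => km kn e _.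
move: co; rewrite /coprime => /eqP co; rewrite co in e.
have := congr1 (fun m => (x *+ m)%R) e => /=.
by rewrite addn1 mulrSr (mulnC km) (mulnC kn) !mulrnA xk0 xV !mul0rn add0r => <-.
Qed.

Lemma sum_inj_eq (V : finType) (g : V -> V) d : injective g ->
  \sum_x (g x == d) = 1.
Proof.
move=> gI; rewrite -(sum_eq_op d) [RHS](reindex_inj gI) /=.
by apply: eq_bigr => x _; rewrite eq_sym.
Qed.

Lemma odd_double_inj (V : finZmodType) : odd #|V| ->
  injective (fun x : V => x + x)%R.
Proof.
move=> oddV x y /eqP; rewrite -!mulr2n -subr_eq0 -mulrnBl => /eqP xy0.
apply/eqP; rewrite -subr_eq0; apply/eqP; apply: mulrn_eq0_coprime xy0 => //.
by rewrite coprimen2.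
Qed.

(** * A one-factorization of the complete graph on V and oo *)

Section OneFactorization.
Variable V : finZmodType.
Hypothesis oddV : odd #|V|.

(* The pairs {x, y} with x + y = 2v, with oo matched to v. *)
Definition partner (v : V) (x : option V) : option V :=
  if x is Some y then if y == v then None else Some (v + v - y)%R else Some v.

(** Enumerating a set lists each edge once, although it arises from both of its ends. *)
Definition factor (v : V) : seq {set option V} :=
  enum [set [set x; partner v x] | x : option V].

Lemma partnerK v : involutive (partner v).
Proof.
case=> [y|] /=; last by rewrite eqxx.
have [->//|nyv] := eqVneq y v => /=.
by rewrite subr_eq (inj_eq (addrI v)) eq_sym (negPf nyv) subKr.
Qed.

(** A fixed point y would satisfy y + y = v + v, hence y = v since the order is odd; but v is
    matched with oo. *)
Lemma partner_neq v x : x != partner v x.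
Proof.
case: x => [y|] //=; have [//|nyv] := eqVneq y v.
rewrite (inj_eq Some_inj) eq_sym subr_eq; apply: contraNneq nyv => e.
by apply/eqP/esym; apply: odd_double_inj e.
Qed.

Lemma factor_card v e : e \in factor v -> #|e| = 2.
Proof.
by rewrite mem_enum => /imsetP [x _ ->]; rewrite cards2 partner_neq.
Qed.

(** Only one edge of the factor contains x. The weight [F] is 1 for the covering property and
    membership of y for the pairs. *)
Lemma sum_factor v x (F : {set option V} -> nat) :
  \sum_(e <- factor v) (x \in e) * F e = F [set x; partner v x].
Proof.
rewrite big_enum /= (bigD1 [set x; partner v x]) /=; last first.
  by apply/imsetP; exists x.
rewrite !inE eqxx mul1n.
rewrite big1 ?addn0 // => _ /andP [/imsetP [y _ ->]].
rewrite !inE; case: (x =P y) => [->|_]; first by rewrite eqxx.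
by case: (x =P _) => //= ->; rewrite partnerK setUC eqxx.
Qed.

Lemma factor_cover v x : count (fun e : {set _} => x \in e) (factor v) = 1.
Proof.
rewrite count_sum -[RHS](sum_factor v x (fun=> 1)).
by apply: eq_bigr => e _; rewrite muln1.
Qed.

(** Points a and b of V are joined exactly in the factor v with v + v = a + b, unique as doubling is
    bijective; oo and a are joined exactly in the factor a. *)
Lemma factor_pair x y : x != y ->
  \sum_v count (fun e : {set _} => (x \in e) && (y \in e)) (factor v) = 1.
Proof.
move=> nxy; transitivity (\sum_v (partner v x == y)).
  apply: eq_bigr => v _; rewrite count_sum.
  under eq_bigr do rewrite -mulnb.
  rewrite (sum_factor v x (fun e => y \in e)) !inE.
  by rewrite [y == x]eq_sym (negPf nxy) /= eq_sym.
case: x y nxy => [a|] [b|] //= nab.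
- rewrite -[RHS](sum_inj_eq (a + b)%R (odd_double_inj oddV)).
  apply: eq_bigr => v _; case: (a =P v) => [<-|_] /=.
    by rewrite (inj_eq (addrI a)); case: (a =P b) nab => // ->; rewrite eqxx.
  by rewrite (inj_eq Some_inj) subr_eq [(b + a)%R]addrC.
- rewrite -[RHS](sum_eq_op a); apply: eq_bigr => v _; by case: (a =P v).
- by rewrite -[RHS](sum_inj_eq b (@inj_id V)).
Qed.

End OneFactorization.

(** * Translates of a base block and their differences *)

Section DifferenceFamily.
Variable V : finZmodType.
Implicit Types (C : seq V) (x d : V).
Local Open Scope ring_scope.

Definition translates C : seq {set V} :=
  [seq [set y in [seq t + x | x <- C]] | t <- enum V].

(** The terms with p = q are included; they contribute only to d = 0. *)
Definition differences C d : nat := (\sum_(p <- C) \sum_(q <- C) ((p - q)%R == d))%N.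

Lemma card_translates C b : uniq C -> b \in translates C -> #|b| = size C.
Proof.
move=> uC /mapP [t _ ->]; rewrite cardsE.
by rewrite (card_uniqP _) ?size_map // map_inj_uniq //; apply: addrI.
Qed.

Lemma mem_translate C t y : uniq C ->
  (y \in [set y in [seq t + x | x <- C]]) = (\sum_(p <- C) (p == (y - t)%R))%N :> nat.
Proof.
move=> uC; rewrite inE -(count_sum (pred1 (y - t))) count_uniq_mem //.
rewrite -{1}[y](subrK t) [y - t + t]addrC mem_map //; exact: addrI.
Qed.

Lemma count_translates C a : uniq C ->
  count (fun b : {set V} => a \in b) (translates C) = size C.
Proof.
move=> uC; rewrite count_sum big_map big_enum /=.
under eq_bigr do rewrite mem_translate //.
rewrite exchange_big /= -sum1_size; apply: eq_bigr => p _.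
rewrite -[RHS](sum_inj_eq p (@subrI _ a)).
by apply: eq_bigr => t _; rewrite eq_sym.
Qed.

(** If a = t + p and b = t + q then p - q = a - b; conversely such p and q determine t = a - p. *)
Lemma count_translates_pair C a b : uniq C ->
  count (fun e : {set V} => (a \in e) && (b \in e)) (translates C)
  = differences C (a - b).
Proof.
move=> uC; rewrite count_sum big_map big_enum /=.
under eq_bigr do rewrite -mulnb !mem_translate // big_distrl /=.
rewrite exchange_big /=; apply: eq_bigr => p _.
under eq_bigr do rewrite big_distrr /=.
rewrite exchange_big /=; apply: eq_bigr => q _.
rewrite (bigD1 (a - p)) //= subKr eqxx mul1n big1 ?addn0 => [|t]; last first.
  apply: contraNeq; rewrite muln_eq0 negb_or eqb0 negbK => /andP [/eqP -> _].
  by rewrite subKr.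
by rewrite -(inj_eq (@subrI _ p)) opprB addrA [p + (a - p)]addrC subrK.
Qed.

End DifferenceFamily.

(** * Strong orthomorphisms and parallelogram designs *)

Definition strong_orthomorphism (V : zmodType) (f : V -> V) : Prop :=
  [/\ forall x, f (- x)%R = (- f x)%R, injective f,
      injective (fun x => f x + x)%R & injective (fun x => f x - x)%R].

Section Parallelograms.
Variables (V : finZmodType) (f : V -> V).
Hypothesis oddV : odd #|V|.
Hypothesis f_orth : strong_orthomorphism f.
Local Open Scope ring_scope.

Let fN : forall x, f (- x) = - f x. Proof. by case: f_orth. Qed.
Let fI : injective f. Proof. by case: f_orth. Qed.
Let faddI : injective (fun x => f x + x). Proof. by case: f_orth. Qed.
Let fsubI : injective (fun x => f x - x). Proof. by case: f_orth. Qed.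

(** Representatives of the nonzero elements up to sign; the enumeration serves as an arbitrary total
    order. *)
Definition half : {set V} := [set x | (enum_rank x < enum_rank (- x))%N].

Lemma opp_eq_self (x : V) : (- x == x) = (x == 0).
Proof.
apply/eqP/eqP => [e|->]; last by rewrite oppr0.
by apply: (odd_double_inj oddV); rewrite addr0 -{1}e addNr.
Qed.

Lemma half_neq0 x : x \in half -> x != 0.
Proof. by apply: contraTneq => ->; rewrite inE oppr0 ltnn. Qed.

Lemma half_opp x : ((x \in half) + ((- x)%R \in half) = (x != 0%R))%N.
Proof.
rewrite !inE opprK; case: eqVneq => [->|x0]; first by rewrite oppr0 ltnn.
case: ltngtP => // /val_inj /enum_rank_inj /eqP.
by rewrite eq_sym opp_eq_self (negPf x0).
Qed.

Lemma orthomorphism0 : f 0 = 0.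
Proof. by apply/eqP; rewrite -opp_eq_self -fN oppr0. Qed.

Definition signed_count (d z : V) : nat := ((z == d) + ((- z)%R == d))%N.

(** The values g x and - g x = g (- x), for x in [half], run once through the nonzero elements. *)
Lemma sum_half (g : V -> V) d : (forall x, g (- x) = - g x) -> injective g ->
  d != 0 -> (\sum_(x in half) signed_count d (g x) = 1)%N.
Proof.
move=> gN gI d0; have g0 : g 0 = 0.
  by apply/eqP; rewrite -opp_eq_self -gN oppr0.
rewrite big_split /= [X in (_ + X)%N](reindex_inj oppr_inj) /=.
under [X in (_ + X)%N]eq_bigr do rewrite gN opprK.
rewrite -[RHS](sum_inj_eq d gI) big_mkcond [X in (_ + X)%N]big_mkcond.
rewrite -big_split; apply: eq_bigr => x _ /=.
have := half_opp x; case: (x =P 0) => [->|_].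
  by rewrite g0 eq_sym (negPf d0); do 2 case: ifP.
by case: (_ \in _); case: (_ \in _) => // _; rewrite addn0.
Qed.

Definition parallelogram x : seq V := [:: 0; x; f x; x + f x].

(** Two equal vertices would make x, f x, f x + x or f x - x vanish. *)
Lemma parallelogram_uniq x : x != 0 -> uniq (parallelogram x).
Proof.
move=> x0; have fx0 : f x != 0 by rewrite -orthomorphism0 (inj_eq fI).
rewrite /= !inE !negb_or [0 == x]eq_sym x0 [0 == f x]eq_sym fx0.
have -> : (0 == x + f x) = false.
  by have := inj_eq faddI x 0; rewrite /= orthomorphism0 addr0 (negPf x0) addrC eq_sym.
have -> : (x == f x) = false.
  by have := inj_eq fsubI x 0; rewrite /= orthomorphism0 subr0 (negPf x0) subr_eq0 eq_sym.
have -> : (x == x + f x) = false.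
  by rewrite -{1}[x]addr0 (inj_eq (addrI x)) eq_sym (negPf fx0).
by rewrite -{1}[f x]add0r (inj_eq (addIr _)) eq_sym x0.
Qed.

Lemma differences_triple (x y d : V) : d != 0 ->
  differences [:: 0; x; y] d =
  (signed_count d x + signed_count d y + signed_count d (y - x)%R)%N.
Proof.
move=> d0; rewrite /differences !big_cons !big_nil /signed_count opprB.
by rewrite !subrr !subr0 !sub0r [0 == d]eq_sym (negPf d0) /=; ring.
Qed.

(** Opposite sides are equal, so x and f x count twice; the two diagonals count once. *)
Lemma differences_parallelogram x d : d != 0 ->
  differences (parallelogram x) d =
  (2 * signed_count d x + 2 * signed_count d (f x)
   + signed_count d (f x + x)%R + signed_count d (f x - x)%R)%N.
Proof.
move=> d0; rewrite /differences !big_cons !big_nil /signed_count opprB.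
have e1 : x - (x + f x) = - f x by rewrite opprD addrA subrr sub0r.
have e2 : f x - (x + f x) = - x by rewrite opprD addrCA subrr addr0.
have e3 : x + f x - x = f x by rewrite addrC addKr.
rewrite !subrr !subr0 !sub0r e1 e2 e3 addrK [f x + x]addrC.
by rewrite [0 == d]eq_sym (negPf d0) /=; ring.
Qed.

Lemma sum_half_parallelogram d : d != 0 ->
  (\sum_(x in half) differences (parallelogram x) d = 6)%N.
Proof.
move=> d0; under eq_bigr do rewrite differences_parallelogram //.
rewrite 3!big_split /= -!big_distrr /= !sum_half // => x.
- by rewrite fN opprD.
- by rewrite fN opprD.
Qed.

Definition parallelogram_blocks : seq {set V} :=
  flatten [seq translates (parallelogram x) | x <- enum half].

Lemma BIBD_parallelogram : is_BIBD 4 6 parallelogram_blocks.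
Proof.
split=> [b /flatten_mapP [x]|a b nab].
  by rewrite mem_enum => /half_neq0 /parallelogram_uniq uC /card_translates ->.
rewrite count_flatten -map_comp sumnE big_map big_enum /=.
rewrite -(@sum_half_parallelogram (a - b)) ?subr_eq0 //.
apply: eq_bigr => x /half_neq0 x0.
by rewrite count_translates_pair ?parallelogram_uniq.
Qed.

(* The base block of x0 and the two triangles below have the same differences,
   because the fourth point of the block is x0 + f x0. *)
Definition extended_blocks x0 : seq {set option V} :=
  [seq Some @: b | b : {set V} <- flatten
     [seq translates (parallelogram x) | x <- enum (half :\ x0)]] ++
  [seq None |: Some @: b | b : {set V} <- translates [:: 0; x0; f x0]
                             ++ translates [:: 0; x0; x0 + f x0]].

Lemma mem_Some_imset (A : {set V}) a : (Some a \in Some @: A) = (a \in A).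
Proof. by rewrite mem_imset //; apply: Some_inj. Qed.

Lemma None_Some_imset (A : {set V}) : (None \in Some @: A) = false.
Proof. by apply/negP => /imsetP []. Qed.

(** A point of V lies in three translates of each triangle, so it meets oo 3 + 3 times. *)
Lemma BIBD_extended x0 : x0 \in half -> is_BIBD 4 6 (extended_blocks x0).
Proof.
move=> x0H; have uP := parallelogram_uniq (half_neq0 x0H).
have u1 : uniq [:: 0; x0; f x0].
  by move: uP; rewrite /= !inE !negb_or => /and4P [/and3P [-> -> _] /andP [-> _]].
have u2 : uniq [:: 0; x0; x0 + f x0].
  by move: uP; rewrite /= !inE !negb_or => /and4P [/and3P [-> _ ->] /andP [_ ->]].
have count_None a :
    count (fun b : {set option V} => (None \in b) && (Some a \in b))
      (extended_blocks x0) = 6%N.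
  rewrite count_cat !count_map count_cat.
  rewrite (eq_count (a2 := pred0)) => [|b]; last by rewrite /= None_Some_imset.
  rewrite count_pred0.
  have e : preim (fun b : {set V} => None |: Some @: b)
             (fun b : {set option V} => (None \in b) && (Some a \in b))
        =1 (fun b : {set V} => a \in b).
    by move=> b; rewrite /= !inE mem_Some_imset.
  by rewrite !(eq_count e) !count_translates.
split=> [b|].
  rewrite mem_cat => /orP [/mapP [c /flatten_mapP [x]]|/mapP [c]].
    rewrite mem_enum => /setD1P [_ /half_neq0 /parallelogram_uniq uC].
    by move=> /(card_translates uC) cc ->; rewrite card_imset //; apply: Some_inj.
  move=> cT ->; rewrite cardsU1 None_Some_imset card_imset; last exact: Some_inj.
  by move: cT; rewrite mem_cat => /orP [/(card_translates u1) ->|/(card_translates u2) ->].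
case=> [a|] [b|] //= nab; last first.
  by rewrite -[RHS](count_None a); apply: eq_count => c; rewrite andbC.
have {}nab : a - b != 0 by rewrite subr_eq0; apply: contraNneq nab => ->.
rewrite count_cat !count_map.
rewrite (eq_count (a2 := fun c : {set V} => (a \in c) && (b \in c))); last first.
  by move=> c /=; rewrite !mem_Some_imset.
rewrite [X in (_ + X)%N](eq_count
  (a2 := fun c : {set V} => (a \in c) && (b \in c))); last first.
  by move=> c /=; rewrite !inE !mem_Some_imset.
rewrite count_cat !count_translates_pair // !differences_triple // addrAC subrr add0r.
rewrite count_flatten -map_comp sumnE big_map big_enum /=.
(* The term of [x0] is split off, to be compared with the two triangles. *)
rewrite -(sum_half_parallelogram nab) [RHS](big_setD1 x0) //= addnC; congr (_ + _)%N.
  by rewrite differences_parallelogram // [x0 + f x0]addrC; ring.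
apply: eq_bigr => x /setD1P [_ /half_neq0 x0'].
by rewrite count_translates_pair ?parallelogram_uniq.
Qed.

End Parallelograms.

(** * Tripling a BIBD with an orthogonal array *)

Section Tripling.
Variables (U : finType) (D : seq {set U}).
Hypothesis D_BIBD : is_BIBD 4 6 D.

(* The rows of the orthogonal array OA(9, 4, 3), columns i < 4. *)
Definition oa_entry (i : nat) (ab : nat * nat) : nat :=
  (nth 0 [:: ab.1; ab.2; ab.1 + ab.2; ab.1 + 2 * ab.2] i) %% 3.

Definition oa_rows : seq (nat * nat) := [seq (a, b) | a <- iota 0 3, b <- iota 0 3].

(** The forms a, b, a + b, a + 2b are pairwise independent mod 3, so two entries determine the row;
    all cases are computed. *)
Lemma oa_strength2 i j y z : i < 4 -> j < 4 -> i != j -> y < 3 -> z < 3 ->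
  count (fun ab => (y == oa_entry i ab) && (z == oa_entry j ab)) oa_rows = 1.
Proof.
by case: i j y z => [|[|[|[|i]]]] [|[|[|[|j]]]] [|[|[|y]]] [|[|[|z]]].
Qed.

Definition fiber_block (u : U) : {set option (U * 'I_3)} :=
  [set p | if p is Some q then q.1 == u else true].

(** The position of a point in [enum Q] selects its column of the array. *)
Definition transversal_block (Q : {set U}) (ab : nat * nat) : {set option (U * 'I_3)} :=
  [set p : option (U * 'I_3) | if p is Some q
           then (q.1 \in Q) && (q.2 == oa_entry (index q.1 (enum Q)) ab :> nat)
           else false].

Definition tripled_blocks : seq {set option (U * 'I_3)} :=
  flatten (nseq 6 [seq fiber_block u | u <- enum U]) ++
  [seq transversal_block Q ab | Q <- D, ab <- oa_rows].

Lemma card_fiber_block u : #|fiber_block u| = 4.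
Proof.
have -> : fiber_block u = None |: [set Some (u, z) | z : 'I_3].
  apply/setP => -[[w z]|]; rewrite !inE //=.
  by apply/eqP/imsetP => [->|[y _ [-> _]]] //; exists z.
rewrite cardsU1 card_imset => [|y z []//]; rewrite card_ord.
by rewrite (_ : None \in _ = false) //; apply/negP => /imsetP [].
Qed.

Lemma card_transversal_block Q ab : #|transversal_block Q ab| = #|Q|.
Proof.
have lt3 u : oa_entry (index u (enum Q)) ab < 3 by rewrite ltn_mod.
rewrite -(card_imset (f := fun u => Some (u, Ordinal (lt3 u)))); last first.
  by move=> u w [].
congr #|pred_of_set _|; apply/setP => -[[u z]|]; rewrite inE /=; last first.
  by apply/esym/negP => /imsetP [].
apply/andP/imsetP => [[uQ /eqP zE]|[w wQ [-> ->]]] //.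
by exists u => //; congr (Some (_, _)); apply: val_inj.
Qed.

Lemma count_fibers (p : pred {set option (U * 'I_3)}) :
  count p (flatten (nseq 6 [seq fiber_block u | u <- enum U])) =
  6 * \sum_u p (fiber_block u).
Proof.
by rewrite count_flatten map_nseq sumn_nseq count_sum big_map big_enum mulnC.
Qed.

Lemma count_transversals (p : pred {set option (U * 'I_3)}) :
  count p [seq transversal_block Q ab | Q <- D, ab <- oa_rows] =
  \sum_(Q <- D) count (fun ab => p (transversal_block Q ab)) oa_rows.
Proof.
rewrite count_flatten -map_comp sumnE big_map.
by apply: eq_bigr => Q _; apply: count_map.
Qed.

Lemma index_enum_lt4 Q u : Q \in D -> u \in Q -> index u (enum Q) < 4.
Proof. by move=> QD uQ; rewrite -(D_BIBD.1 _ QD) cardE index_mem mem_enum. Qed.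

Lemma count_transversal_pair Q rows u w y z :
  count (fun ab => (Some (u, y) \in transversal_block Q ab)
                   && (Some (w, z) \in transversal_block Q ab)) rows =
  ((u \in Q) && (w \in Q)) *
  count (fun ab => (y == oa_entry (index u (enum Q)) ab :> nat)
                   && (z == oa_entry (index w (enum Q)) ab :> nat)) rows.
Proof.
rewrite !count_sum big_distrr; apply: eq_bigr => ab _; rewrite !inE /=.
by rewrite -mulnb -!mulnb; ring.
Qed.

(** Pairs within a fiber or with oo lie only in the six copies of a fiber block. For points over u
    and w distinct, each of the 6 blocks of [D] through u and w yields one transversal. *)
Lemma BIBD_tripled : is_BIBD 4 6 tripled_blocks.
Proof.
have count_None q :
    count (fun b : {set _} => (None \in b) && (Some q \in b)) tripled_blocks = 6.
  rewrite count_cat count_fibers count_transversals [X in _ + X]big1 => [|Q _].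
    under eq_bigr do rewrite /= !inE /=.
    by rewrite sum_eq_op.
  by rewrite -[RHS](count_pred0 oa_rows); apply: eq_count => ab; rewrite /= inE.
split=> [b|].
  rewrite mem_cat => /orP [|/allpairsP [[Q ab] /= [QD _ ->]]].
    case/flattenP => s /nseqP [-> _] /mapP [u _ ->]; exact: card_fiber_block.
  by rewrite card_transversal_block (D_BIBD.1 _ QD).
case=> [[u y]|] [[w z]|] //= nuw; last first.
  by rewrite -[RHS](count_None (u, y)); apply: eq_count => c; rewrite andbC.
rewrite count_cat count_fibers count_transversals.
under eq_bigr do rewrite /= !inE /=.
under [X in _ + X]eq_bigr do rewrite count_transversal_pair.
have [euw|{}nuw] := eqVneq u w.
  rewrite -euw in nuw *; under eq_bigr do rewrite andbb.
  rewrite sum_eq_op big1 // => Q _; apply/eqP; rewrite muln_eq0.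
  (* A transversal has a single entry over u, which would force y = z. *)
  rewrite -[_ == 0 in X in _ || X]leqn0 leqNgt -has_count; apply/orP; right.
  apply: contraNN nuw => /hasP [ab _ /andP [/eqP yE /eqP zE]].
  by apply/eqP; congr (Some (_, _)); apply: val_inj; rewrite /= yE zE.
rewrite big1 => [|v _]; last first.
  by case: (u =P v) => //= <-; rewrite eq_sym (negPf nuw).
rewrite muln0 add0n -(D_BIBD.2 _ _ nuw) count_sum big_seq [RHS]big_seq.
apply: eq_bigr => Q QD; case uQ: (u \in Q); last by rewrite mul0n.
case wQ: (w \in Q); last by rewrite mul0n.
rewrite mul1n oa_strength2 ?index_enum_lt4 ?ltn_ord //.
apply: contraNneq nuw => /(congr1 (nth u (enum Q))).
by rewrite !nth_index ?mem_enum // => ->.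
Qed.

End Tripling.

(** * Existence of strong orthomorphisms *)

(** Here f + 1 is tripling and f - 1 is the identity. *)
Lemma strong_orthomorphism_double (V : finZmodType) : coprime #|V| 6 ->
  strong_orthomorphism (fun x : V => x *+ 2)%R.
Proof.
rewrite -[6]/(2 * 3) coprimeMr => /andP [co2 co3].
have inj k : 0 < k -> coprime #|V| k -> injective (fun x : V => x *+ k)%R.
  move=> k0 co x y /eqP; rewrite -subr_eq0 -mulrnBl => /eqP /(mulrn_eq0_coprime k0 co).
  by move/eqP; rewrite subr_eq0 => /eqP.
split=> [x||x y|x y]; first by rewrite mulNrn.
- exact: inj.
- by rewrite -!mulrSr; apply: inj.
- by rewrite !mulr2n !addrK.
Qed.

Lemma strong_orthomorphism_field (F : finFieldType) : 3 < #|F| ->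
  exists f : F -> F, strong_orthomorphism f.
Proof.
move=> F3; have /set0Pn [a] : ~: [set 0; 1; -1]%R != set0 :> {set F}.
  rewrite -card_gt0 cardsCs setCK subn_gt0 (leq_ltn_trans _ F3) //.
  apply: leq_trans (leq_card_setU _ _).1 _.
  by rewrite cards1 cards2 addn1 !ltnS leq_b1.
rewrite !inE !negb_or => /andP [/andP [a0 a1] aN1].
exists ( *%R a); split=> [x||x y|x y].
- exact: mulrN.
- exact: mulfI.
- rewrite -{2}[x]mul1r -{2}[y]mul1r -!mulrDl.
  by apply: mulfI; rewrite addr_eq0.
- rewrite -{2}[x]mul1r -{2}[y]mul1r -!mulrBl.
  by apply: mulfI; rewrite subr_eq0.
Qed.

(* The library has no finZmodType instance on products; this infers it. *)
HB.saturate prod.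

Lemma strong_orthomorphism_prod (V W : zmodType) (f : V -> V) (g : W -> W) :
  strong_orthomorphism f -> strong_orthomorphism g ->
  strong_orthomorphism (fun x : V * W => (f x.1, g x.2)).
Proof.
move=> [fN fI fD fB] [gN gI gD gB].
split=> [[x y]|[x y] [z t]|[x y] [z t]|[x y] [z t]] /=.
- by rewrite fN gN.
- by case=> /fI -> /gI ->.
- by case=> /fD -> /gD ->.
- by case=> /fB -> /gB ->.
Qed.

(** The part of v prime to 3 is the order of a cyclic group with doubling. The 3-part, if not 1, is
    at least 9 and is the order of a field. *)
Lemma exists_strong_orthomorphism v : odd v -> logn 3 v != 1 ->
  exists (V : finZmodType) (f : V -> V), #|V| = v /\ strong_orthomorphism f.
Proof.
move=> v_odd v3; have v0 : 0 < v by case: v v_odd {v3}.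
pose u := v`_3^'.
have u0 : 0 < u by apply: part_gt0.
have co6 : coprime u 6.
  rewrite -[6]/(2 * 3) coprimeMr coprimen2 (dvdn_odd (dvdn_part _ _) v_odd) /=.
  by rewrite coprime_sym prime_coprime // -p'natE // part_pnat.
have vE : v = u * 3 ^ logn 3 v by rewrite -p_part mulnC partnC.
have [U [f [cU fO]]] : exists (V : finZmodType) (f : V -> V),
    #|V| = u /\ strong_orthomorphism f.
  have cU : #|'I_u.-1.+1| = u by rewrite card_ord prednK.
  by exists 'I_u.-1.+1, (fun x => x *+ 2)%R; split=> //;
    apply: strong_orthomorphism_double; rewrite cU.
case e: (logn 3 v) => [|k]; first by exists U, f; rewrite vE e muln1.
have [F _ cF] := @pPrimePowerField 3 k.+1 isT isT.
have [|g gO] := @strong_orthomorphism_field F.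
  by rewrite cF; case: k e {cF} => [|k] e; [rewrite e in v3 | rewrite !expnS; lia].
exists (U * F)%type, (fun x => (f x.1, g x.2)); split.
  by rewrite card_prod cU cF vE e.
exact: strong_orthomorphism_prod.
Qed.

(** * Existence of the BIBD and of the design *)

Lemma exists_BIBD_option v : odd v -> 1 < v ->
  exists (V : finZmodType) (D : seq {set option V}), #|V| = v /\ is_BIBD 4 6 D.
Proof.
move=> v_odd v1; have [v3|v3] := eqVneq (logn 3 v) 1.
  have v0 : 0 < v by apply: ltnW.
  have vE : v = v`_3^' * 3 by rewrite -[LHS](partnC 3) // p_part v3 mulnC.
  have [||U [f [cU fO]]] := @exists_strong_orthomorphism v`_3^'.
  - exact: dvdn_odd (dvdn_part _ _) v_odd.
  - have n3 : ~~ (3 %| v`_3^') by rewrite -p'natE // part_pnat.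
    by rewrite lognE (negPf n3) !andbF.
  (* For v = 3 the group [U] is trivial and has no parallelograms; six copies of one fiber block
     remain. *)
  have oU : odd #|U| by rewrite cU; apply: dvdn_odd (dvdn_part _ _) v_odd.
  exists (U * 'I_3)%type, (tripled_blocks (parallelogram_blocks f)); split.
    by rewrite card_prod card_ord cU.
  exact/BIBD_tripled/BIBD_parallelogram.
have [V [f [cV fO]]] := exists_strong_orthomorphism v_odd v3.
have oV : odd #|V| by rewrite cV.
have /card_gt0P [x] : 0 < #|[set~ (0 : V)%R]|.
  by rewrite cardsC1 cV; case: (v) v1 => [|[]].
rewrite !inE => x0; have := half_opp oV x; rewrite x0.
(* One of x and - x lies in [half] and serves as the base block to be replaced. *)
have [xH _|_ ] := boolP (x \in half V).
  by exists V, (extended_blocks f x); split=> //; apply: BIBD_extended.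
case: (boolP (_ \in _)) => // xH _.
by exists V, (extended_blocks f (- x)%R); split=> //; apply: BIBD_extended.
Qed.

Theorem corollary5p2 (n : nat) (hn : 4 <= n)
  (hmod : n %% 56 \in [:: 2; 6; 10; 14; 18; 26; 30; 34; 38; 42; 46; 54]) :
  exists (X : finType) (P : {set {set X}}) (B : seq {set X}),
    is_GDD n 2 6 ((7 * n) %/ 2) (4 * (n - 1)) P B /\
    has_configuration 2 4 P B.
Proof.
have n_even : ~~ odd n.
  (* The listed residues and 56 are all even. *)
  have : ~~ odd (n %% 56) by move: hmod; rewrite !inE; do !case/predU1P => [->//|]; move/eqP->.
  by rewrite [in X in _ -> X](divn_eq n 56) oddD oddM andbF.
have nE : n = n./2.*2 by rewrite even_halfK.
have [||V [D [cV D_BIBD]]] := @exists_BIBD_option n.-1.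
- by rewrite -subn1 oddB ?(ltn_trans _ hn) // (negPf n_even).
- by case: n hn {hmod n_even nE} => [|[|[]]].
have oV : odd #|V| by rewrite cV nE -[_.*2]prednK ?oddS //; lia.
exists (bool * option V)%type, [set group _ true; group _ false],
  (blocks D (@factor V) n./2).
have -> : 7 * n %/ 2 = 7 * n./2 by lia.
have -> : 4 * (n - 1) = 4 * (n./2).*2.-1 by lia.
rewrite {1}nE; apply: GDD_blocks => //.
- by rewrite card_option cV; lia.
- by lia.
- by rewrite cV; lia.
- exact: factor_card.
- exact: factor_cover.
- exact: factor_pair.
Qed.
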